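(* There exist absolute constants $\mathfrak{k}>0$ and $C_0>0$ such that for every prime number $p$ there exist positive integers $q$ and $a$ with $0<a<q$, $\gcd(a,q)=1$, $q\equiv 0 \pmod p$ and $q\le C_0\, p^{30}$, such that all partial quotients of the continued fraction expansion of $a/q$ are bounded by $\mathfrak{k}$.
   Context: For coprime positive integers $0<a<q$, the rational number $a/q$ is uniquely represented as a regular continued fraction $$\frac{a}{q}=[0;b_1,\dots,b_s]=\cfrac{1}{b_1+\cfrac{1}{b_2+\cdots+\cfrac{1}{b_s}}},\qquad b_s\ge 2,$$ with positive integers $b_1,\dots,b_s$, called the partial quotients of $a/q$. ''All partial quotients are bounded by $\mathfrak{k}$'' means $b_j\le \mathfrak{k}$ for all $1\le j\le s$. *)

(* Defs.v *)
From mathcomp Require Import all_boot all_order all_algebra.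
From mathcomp Require Import reals.

Set Implicit Arguments.
Unset Strict Implicit.
Unset Printing Implicit Defensive.

Import Order.TTheory GRing.Theory Num.Theory.
Local Open Scope ring_scope.

(* cf_value [:: b_1; ...; b_s] is [0; b_1, ..., b_s]; the empty list gives 0,
   so that cf_value [:: b_s] = 1 / b_s. *)
Fixpoint cf_value (b : seq nat) : rat :=
  if b is b1 :: b' then (b1%:R + cf_value b')^-1 else 0.

(* b lists the partial quotients of x in the normalization b_s >= 2, which
   makes b unique. The default 0 of last excludes the empty list. *)
Definition partial_quotients (x : rat) (b : seq nat) : Prop :=
  [/\ all (fun bj => (0 < bj)%N) b, (2 <= last 0%N b)%N & x = cf_value b].

Definition partial_quotients_bounded (k : nat) (x : rat) : Prop :=
  exists2 b : seq nat, partial_quotients x b & all (fun bj => (bj <= k)%N) b.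

(* Main.v *)
Require Import Defs.
From mathcomp Require Import all_boot all_order all_algebra.
From mathcomp Require Import reals.
From mathcomp Require Import zify ring lra.

Import Order.TTheory GRing.Theory Num.Theory.

(* Let M(w) be the product of the matrices [[b, 1], [1, 0]] over the letters b
   of a word w; its upper left entry is the denominator of [0; w]. For words
   x, a, y the denominator of x ++ a ++ rev y is a bilinear form in the first
   rows of M(x) and M(y) with matrix M(a), and it has to vanish mod p.

   Averaging over all matrices g of determinant s over F_p shows that for
   X, Y subsets of F_p, all but 3 p^4 / (|X| |Y|) of them admit x in X and y in
   Y with (1, x) g (1, y)^T = 0. So it is enough to find sets of words with
   letters at most k whose rows with entries below p^(1/2) give about
   p^(1 - epsilon) ratios mod p, and whose matrices M(a) give more than
   p^(2 + delta) residues mod p, for some delta > 2 epsilon.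

   There are about N^(2 - epsilon) words with denominator of order N, where
   epsilon tends to 0 as k grows: each letter cuts a cylinder into pieces that
   lose only a fraction 2 / (k + 1) of its length. For N = p^(1 + eta) most of
   the matrices M(a) are distinct mod p: if a' = a + p c is another one, then
   det a = det a' factors (c1 a2 - a1 c2) (c1 a3 - a1 c3) as a nonzero integer
   depending only on det a, c and a1, and the divisor bound O(n^(1/3)) leaves
   p^(O(eta)) N^(5/3) possibilities for a. *)

(** * A divisor bound *)

Lemma size_divisors_part p n : (0 < n) ->
  (size (divisors n) <= (logn p n).+1 * size (divisors n`_p^')).
Proof.
move=> n0; pose ds := [seq (p ^ i * d) | i <- iota 0 (logn p n).+1, d <- divisors n`_p^'].
have -> : ((logn p n).+1 * size (divisors n`_p^') = size ds).
  by rewrite size_allpairs size_iota.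
apply: uniq_leq_size (divisors_uniq n) _ => e; rewrite -dvdn_divisors // => en.
have e0 : (0 < e) := dvdn_gt0 n0 en.
apply/allpairsP; exists (logn p e, e`_p^'); split.
- by rewrite mem_iota add0n ltnS dvdn_leq_log.
- by rewrite -dvdn_divisors ?part_gt0 // partn_dvd.
- by rewrite -p_part partnC.
Qed.

(** A prime power p^a exactly dividing n contributes a + 1 to the divisor count. For p >= 8 the cube
    of this is at most p^a because a + 1 <= 2^a; smaller primes cost a constant, below. *)
Lemma cube_le_exp8 a p : (8 <= p) -> (a.+1 ^ 3 <= p ^ a).
Proof.
move=> p8; apply: (@leq_trans (8 ^ a)); last first.
  by case: a => // a; rewrite leq_exp2r.
by rewrite -[8%N]/(2 ^ 3) expnAC leq_exp2r // ltn_expl.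
Qed.

Lemma cube_le_exp2 a p : (2 <= p) -> (a.+1 ^ 3 <= 8 * p ^ a).
Proof.
move=> p2; apply: (@leq_trans (8 * 2 ^ a)); last first.
  by rewrite leq_mul2l /=; case: a => // a; rewrite leq_exp2r.
case: a => [|[|[|a]]] //; elim: a => [|a IH] //.
(* From a = 3 on, (a + 1)^3 grows by a factor of at most 2, so (a + 1)^3 / 2^a is largest at a = 3,
   where it equals 8. *)
have : a.+4.+1 ^ 3 <= 2 * a.+4 ^ 3 by rewrite !expnS !expn0; nia.
by rewrite [X in _ <= 8 * X]expnS; lia.
Qed.

Lemma size_divisors_cube_rough n : (0 < n) ->
  (forall p, prime p -> (p %| n) -> (8 <= p)) ->
  (size (divisors n) ^ 3 <= n).
Proof.
elim/ltn_ind: n => n IH n0 rough.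
have [n1|n1] := leqP n 1; first by have -> : n = 1%N by lia.
have pr := pdiv_prime n1; set p := pdiv n in pr.
have m0 : (0 < n`_p^') := part_gt0 _ _.
have a0 : (0 < logn p n) by rewrite logn_gt0 mem_primes pr n0 pdiv_dvd.
have nE := partnC p n0; rewrite p_part in nE.
have mlt : (n`_p^' < n).
  rewrite -{2}nE -{1}[n`_p^']mul1n ltn_mul2r m0 /=.
  by rewrite -[X in (X < _)](exp1n (logn p n)) ltn_exp2r // prime_gt1.
have {}IH := IH _ mlt m0 (fun r prr rm => rough r prr (dvdn_trans rm (dvdn_part _ _))).
have p8 := rough _ pr (pdiv_dvd n).
rewrite -[X in (_ <= X)]nE; apply: leq_trans (leq_mul (cube_le_exp8 _ _ p8) IH).
by rewrite -expnMn leq_exp2r // size_divisors_part.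
Qed.

(** Lowers by one the threshold for the prime factors of n. Only a prime q costs the factor 8,
    through [cube_le_exp2]. *)
Lemma size_divisors_cube_step q C :
  (forall n, (0 < n) -> (forall p, prime p -> (p %| n) -> (q < p)) ->
    (size (divisors n) ^ 3 <= C * n)) ->
  forall n, (0 < n) -> (forall p, prime p -> (p %| n) -> (q <= p)) ->
    (size (divisors n) ^ 3 <= 8 * C * n).
Proof.
move=> H n n0 rough; have [pr|npr] := boolP (prime q); last first.
  apply: leq_trans (H n n0 _) _ => [p pp pn|]; last by rewrite leq_mul2r leq_pmull ?orbT.
  by rewrite ltn_neqAle rough // andbT; apply: contraNneq npr => ->.
have m0 : (0 < n`_q^') := part_gt0 _ _.
have nE := partnC q n0; rewrite p_part in nE.
have Hm := H _ m0 _.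
rewrite -[X in (_ <= _ * X)]nE mulnACA.
apply: leq_trans (leq_mul (cube_le_exp2 (logn q n) q (prime_gt1 pr)) (Hm _)).
  by rewrite -expnMn leq_exp2r // size_divisors_part.
move=> p pp pm; rewrite ltn_neqAle rough ?andbT //; last exact: dvdn_trans pm (dvdn_part _ _).
apply: contraTneq pm => <-; rewrite -prime_coprime // coprime_sym.
by apply: p'nat_coprime (part_pnat _ _) (pnat_id pr).
Qed.

Lemma size_divisors_bound :
  exists C, forall n r, (0 < n <= r ^ 3) -> (size (divisors n) <= C * r).
Proof.
have [C H] : exists C, forall n, (0 < n) -> (size (divisors n) ^ 3 <= C * n).
  (* The second 8 is generalized to j: the threshold 8 - j descends to 0 in eight steps. *)
  have : exists C, forall n, (0 < n) ->
      (forall p, prime p -> (p %| n) -> (8 - 8 <= p)) ->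
      (size (divisors n) ^ 3 <= C * n).
    elim: {2}8 => [|j [C IH]].
      by exists 1%N => n n0 rough; rewrite mul1n size_divisors_cube_rough.
    exists (8 * C); apply: size_divisors_cube_step => n n0 rough.
    by apply: IH => // p pp pn; have := rough p pp pn; lia.
  by case=> C H; exists C => n n0; apply: H.
exists C => n r /andP[n0 nr]; rewrite -(@leq_exp2r _ _ 3) // expnMn.
apply: leq_trans (H n n0) (leq_mul _ nr).
by case: C {H} => // C; rewrite -[X in (X <= _)]expn1 leq_pexp2l.
Qed.

Local Open Scope ring_scope.

(** * Continuants *)

(** This is the row vector u times M(w). So [run w (1, 0)] is the first row of M(w), the last two
    denominators of [0; w], and [run w (0, 1)] is the second row, the last two numerators. *)
Definition run (w : seq nat) (u : nat * nat) : nat * nat :=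
  foldl (fun v b => (b * v.1 + v.2, v.1)%N) u w.

Lemma run_cons b w u : run (b :: w) u = run w (b * u.1 + u.2, u.1)%N.
Proof. by []. Qed.

Lemma run_cat v w u : run (v ++ w) u = run w (run v u).
Proof. exact: foldl_cat. Qed.

Lemma run_rcons w b u :
  run (rcons w b) u = (b * (run w u).1 + (run w u).2, (run w u).1)%N.
Proof. by rewrite /run foldl_rcons. Qed.

Lemma run_linear w u :
  run w u = (u.1 * (run w (1, 0)%N).1 + u.2 * (run w (0, 1)%N).1,
             u.1 * (run w (1, 0)%N).2 + u.2 * (run w (0, 1)%N).2)%N.
Proof.
elim/last_ind: w => [|w b IH] /=; first by case: u => a c /=; congr pair; lia.
by rewrite !run_rcons /= IH /=; congr pair; ring.
Qed.

(** Each factor [[b, 1], [1, 0]] is symmetric, so M(rev w) is the transpose of M(w). *)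
Lemma run_rev w u :
  (run (rev w) u).1 = (u.1 * (run w (1, 0)%N).1 + u.2 * (run w (1, 0)%N).2)%N.
Proof.
elim/last_ind: w u => [|w b IH] [u1 u2]; first by rewrite /=; lia.
by rewrite rev_rcons run_cons IH run_rcons /=; ring.
Qed.

Lemma run_det w :
  (run w (1, 0)%N).1%:Z * (run w (0, 1)%N).2%:Z
    - (run w (1, 0)%N).2%:Z * (run w (0, 1)%N).1%:Z = (-1) ^+ size w.
Proof.
elim/last_ind: w => [|w b IH] //.
by rewrite !run_rcons size_rcons exprS -IH /=; ring.
Qed.

Lemma run_coprime_row w : coprime (run w (1, 0)%N).1 (run w (1, 0)%N).2.
Proof.
elim/last_ind: w => [|w b IH] //.
by rewrite run_rcons /= coprime_sym /coprime gcdnMDl -/(coprime _ _).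
Qed.

Lemma run_coprime_col w : coprime (run w (1, 0)%N).1 (run w (0, 1)%N).1.
Proof.
elim: w => [|b w IH] //.
rewrite !run_cons (run_linear w (_, _)) /= !muln1 !muln0 !addn0 !mul1n.
by rewrite coprime_sym /coprime gcdnMDl -/(coprime _ _).
Qed.

Lemma run_pos w u : all (leq 1) w -> (0 < u.1)%N -> (0 < (run w u).1)%N.
Proof.
elim: w u => [|b w IH] u //= /andP[b0 w0] u0.
by apply: IH => //=; nia.
Qed.

Lemma run_le w u v : (u.1 <= v.1)%N -> (u.2 <= v.2)%N ->
  ((run w u).1 <= (run w v).1)%N /\ ((run w u).2 <= (run w v).2)%N.
Proof.
elim: w u v => [|b w IH] u v // h1 h2.
by rewrite !run_cons; apply: IH => //=; nia.
Qed.

(* Strict decrease holds from (2, 1) on but fails at (1, 1): this is why all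
   words below start with 2. *)
Lemma run_decr w u : all (leq 1) w -> (0 < u.2 < u.1)%N ->
  (0 < (run w u).2 < (run w u).1)%N.
Proof.
elim: w u => [|b w IH] u //= /andP[b0 w0] u0.
by apply: IH => //=; nia.
Qed.

(** Euclid's algorithm reads the word off from its end: as the entries of each pair strictly
    decrease, the last letter is the quotient of the final pair, and the remainder gives the pair
    before it. *)
Lemma run_inj v w : all (leq 1) v -> all (leq 1) w ->
  run v (2, 1)%N = run w (2, 1)%N -> v = w.
Proof.
have D s : all (leq 1) s -> (0 < (run s (2, 1)%N).2 < (run s (2, 1)%N).1)%N.
  by move=> s1; apply: run_decr.
elim/last_ind: v w => [|v b IH]; elim/last_ind => [|w c _] //.
(* A nonempty word cannot return to (2, 1): the pair before would have first entry 1 above a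
   positive second entry. *)
- rewrite all_rcons => _ /andP[c1 w1]; rewrite run_rcons => -[].
  by have := D _ w1; nia.
- rewrite all_rcons => /andP[b1 v1] _; rewrite run_rcons => -[].
  by have := D _ v1; nia.
rewrite !all_rcons => /andP[b1 v1] /andP[c1 w1].
rewrite !run_rcons => -[E1 E2].
have := D _ v1; have := D _ w1.
move: E1 E2 IH; case E: (run v _) => [q q']; case E': (run w _) => [r r'] /=.
move=> E1 qr IH lt1 lt2; subst r.
have bc : b = c by nia.
have q'r' : q' = r' by nia.
by rewrite bc (IH w) // E' q'r'.
Qed.

Lemma cf_value_run w : all (leq 1) w ->
  cf_value w = (run w (0, 1)%N).1%:R / (run w (1, 0)%N).1%:R.
Proof.
elim: w => [|b w IH] /=; first by rewrite mul0r.
move=> /andP[b1 w1]; rewrite IH // muln1 muln0 addn0 add0n (run_linear w (b, 1%N)) /=.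
have q0 : (0 < (run w (1, 0)%N).1)%N by apply: run_pos.
rewrite mul1n natrD natrM.
have : ((run w (1, 0)%N).1%:R : rat) != 0 by rewrite pnatr_eq0; lia.
set Q := (run w (1, 0)%N).1%:R => Q0; set P := (run w (0, 1)%N).1%:R.
by rewrite -[in LHS](mulfK Q0 b%:R) -mulrDl invf_div.
Qed.

(** * Counting words with denominators of a given order *)

(** A word becomes a leaf as soon as its denominator reaches [L], so the cylinders of the leaves are
    disjoint. [u] holds the last two denominators; [n] bounds the depth, and branches still below
    [L] at that depth are dropped. *)
Fixpoint tree (k L n : nat) (u : nat * nat) : seq (seq nat) :=
  if (L <= u.1)%N then [:: [::]] else
  if n is n'.+1 then
    [seq b :: s | b <- iota 1 k, s <- tree k L n' (b * u.1 + u.2, u.1)%N]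
  else [::].

Lemma tree_uniq k L n u : uniq (tree k L n u).
Proof.
elim: n u => [|n IH] u /=; case: ifP => // _.
apply: allpairs_uniq_dep => [|b _|]; rewrite ?iota_uniq ?IH //.
by move=> [b s] [c r] _ _ /= [-> ->].
Qed.

Lemma tree_letters k L n u s :
  s \in tree k L n u -> all (fun b => 0 < b <= k)%N s.
Proof.
elim: n u s => [|n IH] u s /=; case: ifP => // _; rewrite ?inE.
- by move/eqP->.
- by move/eqP->.
case/allpairsPdep => b [r [bk rT ->]] /=.
by rewrite (IH _ _ rT) andbT; move: bk; rewrite mem_iota; lia.
Qed.

Lemma tree_bounds k L n u s : (u.2 <= u.1)%N -> (u.1 <= k.+1 * L)%N ->
  s \in tree k L n u -> (L <= (run s u).1 <= k.+1 * L)%N.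
Proof.
elim: n u s => [|n IH] u s h1 h2 /=; case: ifP => // lt; rewrite ?inE.
- by move/eqP->; rewrite lt.
- by move/eqP->; rewrite lt.
case/allpairsPdep => b [r [bk rT ->]] /=.
by move: bk; rewrite mem_iota => bk; apply: IH rT => /=; nia.
Qed.

(* When u consists of the last two denominators after reading a word, this is the
   length of the interval of continued fractions starting with that word. *)
Definition cylinder (u : nat * nat) : rat := (u.1 * (u.1 + u.2))%:R^-1.

(** With u = (q, q') the sum telescopes: its terms are (1 / (b q + q') - 1 / ((b + 1) q + q')) /
    q. *)
Lemma cylinder_split k u : (0 < u.1)%N ->
  \sum_(b <- iota 1 k) cylinder (b * u.1 + u.2, u.1)%N =
  cylinder u * (k * u.1)%:R / (k.+1 * u.1 + u.2)%:R.
Proof.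
rewrite /cylinder; case: u => q q' /= q0.
have H (n : nat) : n.+1%:R * q%:R + q'%:R != 0 :> rat.
  by rewrite -natrM -natrD pnatr_eq0; nia.
have Hq : (q%:R : rat) != 0 by rewrite pnatr_eq0; lia.
elim: k => [|k IH]; first by rewrite big_nil mul0n mulr0 mul0r.
have -> : iota 1 k.+1 = iota 1 k ++ [:: k.+1] by rewrite -(addn1 k) iotaD add1n addn1.
rewrite big_cat big_seq1 IH /=.
have := H k; have := H 0%N; have := H k.+1.
rewrite !(natrM, natrD) -!natr1 => H1 H2 H3.
field; rewrite Hq H3 H1 /= andbT.
by move: H2; rewrite add0r mul1r.
Qed.

(** Letters above k take up the fraction (q + q') / ((k + 1) q + q') of the cylinder, and q' <=
    q. *)
Lemma cylinder_loss k u : (0 < u.1)%N -> (u.2 <= u.1)%N ->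
  (1 - 2 / k.+1%:R) * cylinder u
    <= \sum_(b <- iota 1 k) cylinder (b * u.1 + u.2, u.1)%N.
Proof.
move=> q0 le21; rewrite cylinder_split // -mulrA mulrC.
apply: ler_wpM2l; first by rewrite invr_ge0 ler0n.
case: u q0 le21 => q q' /= q0 le21.
rewrite ler_pdivlMr; last by rewrite ltr0n; nia.
have k0 : (0 : rat) < k.+1%:R by rewrite ltr0n.
rewrite -(ler_pM2l k0) mulrA mulrBr mulr1 mulrCA divff ?mulr1; last by lra.
rewrite !(natrM, natrD) -!natr1.
have : (q'%:R : rat) <= q%:R by rewrite ler_nat.
have : (0 : rat) <= k%:R by rewrite ler0n.
have : (0 : rat) <= q'%:R by rewrite ler0n.
have : (0 : rat) < q%:R by rewrite ltr0n.
by nra.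
Qed.

(** Each of at most n levels keeps the fraction 1 - 2 / (k + 1). The last hypothesis ensures that no
    branch is dropped: every letter at least doubles u.1 (u.1 + u.2), so at depth n the denominator
    has reached [L]. *)
Lemma tree_weight k L n u : (0 < k)%N -> (0 < u.1)%N -> (u.2 <= u.1)%N ->
  (2 * L ^ 2 <= 2 ^ n * (u.1 * (u.1 + u.2)))%N ->
  (1 - 2 / k.+1%:R) ^+ n * cylinder u
    <= \sum_(s <- tree k L n u) cylinder (run s u).
Proof.
move=> k0 + + +.
have r0 : 0 <= 1 - 2 / k.+1%:R :> rat.
  by rewrite subr_ge0 ler_pdivrMr ?ltr0n // mul1r (ler_nat _ 2).
have r1 : 1 - 2 / k.+1%:R <= 1 :> rat by rewrite gerBl divr_ge0 ?ler0n.
have c0 v : 0 <= cylinder v by rewrite invr_ge0 ler0n.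
elim: n u => [|n IH] u u0 le21 /= h.
  case: ifP => [_|]; first by rewrite big_seq1 expr0 mul1r.
  by nia.
case: ifP => [_|/negbT lt]; first by rewrite big_seq1 ler_piMl // exprn_ile1.
rewrite big_allpairs_dep exprSr -mulrA.
have loss := ler_wpM2l (exprn_ge0 n r0) (cylinder_loss k u u0 le21).
apply: (le_trans loss); clear loss.
rewrite mulr_sumr big_seq [X in _ <= X]big_seq; apply: ler_sum => b.
rewrite mem_iota => b1; apply: IH => /=; [nia|nia|].
apply: leq_trans h _; rewrite expnS -(mulnA 2) mulnCA leq_mul2l.
apply/orP; right; move: b1; case: u {u0 le21 lt} => q q' /= b1.
by rewrite mulnA [X in (_ <= X)%N]mulnC leq_mul //; nia.
Qed.

(** The cylinder of (2, 1) has length 1/6 and each leaf has length at most L^-2, so there are at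
    least r^n L^2 / 6 leaves, where r = 1 - 2 / (k + 1). Bernoulli gives r^m >= 1/2, hence r^(n m)
    >= 1 / (4 L^2). Taking m-th powers avoids the exponent 2 - 2/m. *)
Lemma tree_size k m L n : (0 < m)%N -> (4 * m <= k)%N -> (0 < L)%N ->
  (2 * L ^ 2 <= 2 ^ n <= 4 * L ^ 2)%N ->
  (L ^ (2 * m) <= (6 * size (tree k L n (2, 1))) ^ m * (4 * L ^ 2))%N.
Proof.
move=> m0 mk L0 /andP[n1 n2].
set T := tree _ _ _ _; set r : rat := 1 - 2 / k.+1%:R.
have r0 : 0 <= r.
  by rewrite subr_ge0 ler_pdivrMr ?ltr0n // mul1r (ler_nat _ 2); lia.
have rm : 1 / 2 <= r ^+ m.
  have bern j : 1 - j%:R * (2 / k.+1%:R) <= r ^+ j.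
    elim: j => [|j IH]; first by rewrite mul0r subr0.
    rewrite exprSr -natr1; move: r0 IH.
    have : 0 <= 2 / k.+1%:R :> rat by rewrite divr_ge0 ?ler0n.
    rewrite /r; set x := 2 / _; have := ler0n rat j; set J := j%:R.
    set y := (_ ^+ _); nra.
  apply: le_trans (bern m).
  have : m%:R * (2 / k.+1%:R) <= 1 / 2 :> rat.
    rewrite mulrA ler_pdivrMr ?ltr0n // -(natr1 k).
    have : (4 * m)%:R <= k%:R :> rat by rewrite ler_nat.
    by rewrite natrM; set K := k%:R; set M := m%:R; lra.
  by set z := m%:R * _ => zl; lra.
have w : r ^+ n / 6 <= (size T)%:R / (L ^ 2)%:R.
  have := tree_weight k L n (2, 1)%N; rewrite -/T -/r => H.
  have k0 : (0 < k)%N by lia.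
  have base : (2 * L ^ 2 <= 2 ^ n * (2 * (2 + 1)))%N.
    by apply: leq_trans n1 (leq_pmulr _ _).
  have := H k0 isT isT base; rewrite /cylinder /= => {}H.
  apply: (le_trans H).
  rewrite -(sum1_size T) natr_sum mulr_suml.
  rewrite big_seq [X in _ <= X]big_seq; apply: ler_sum => s sT.
  have Ls : (L <= (run s (2, 1)%N).1)%N.
    have kL : (2 <= k.+1 * L)%N by nia.
    by have /andP[] := tree_bounds k L n (2, 1)%N s isT kL sT.
  by rewrite mul1r lef_pV2 ?posrE ?ltr0n ?ler_nat; nia.
have rnm : 1 <= r ^+ n ^+ m * (4 * L ^ 2)%:R.
  rewrite exprAC; have : 2^-1 ^+ n <= r ^+ m ^+ n.
    by rewrite lerXn2r ?nnegrE ?invr_ge0 ?exprn_ge0 //; lra.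
  have : 2 ^+ n <= (4 * L ^ 2)%:R :> rat by rewrite -natrX ler_nat.
  rewrite exprVn => a1 a2.
  have t0 : (0 : rat) < 2 ^+ n by rewrite exprn_gt0.
  rewrite -[X in X <= _](mulVf (lt0r_neq0 t0)).
  apply: ler_pM; rewrite ?invr_ge0 ?(ltW t0) //.
rewrite -(ler_nat rat) natrM.
have w' : r ^+ n * (L ^ 2)%:R <= (6 * size T)%:R.
  move: w; rewrite ler_pdivlMr ?ltr0n; last by nia.
  by rewrite natrM; lra.
have : (r ^+ n * (L ^ 2)%:R) ^+ m <= (6 * size T)%:R ^+ m.
  by rewrite lerXn2r // nnegrE ?mulr_ge0 ?exprn_ge0 ?ler0n.
rewrite -natrX exprMn => w2.
apply: le_trans (ler_wpM2r (ler0n _ _) w2).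
by rewrite mulrAC expnM natrX ler_peMl ?exprn_ge0 ?ler0n.
Qed.

(** The depth is the least n with 2 L^2 <= 2^n, as [tree_weight] requires. *)
Definition words (k L : nat) : seq (seq nat) :=
  [seq 2%N :: s | s <- tree k L (up_log 2 (2 * L ^ 2)%N) (2, 1)%N].

Lemma words_uniq k L : uniq (words k L).
Proof. by rewrite map_inj_uniq ?tree_uniq // => s s' []. Qed.

Lemma wordsP k L w : (0 < L)%N -> (1 < k)%N -> w \in words k L ->
  [/\ head 0%N w = 2%N, all (fun b => 0 < b <= k)%N w,
      (L <= (run w (1, 0)%N).1 <= k.+1 * L)%N,
      ((run w (1, 0)%N).1 <= k.+1 * (run w (1, 0)%N).2)%N &
      (0 < (run w (1, 0)%N).2 < (run w (1, 0)%N).1)%N].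
Proof.
move=> L0 k1 /mapP[s sT ->].
have sk := tree_letters _ _ _ _ _ sT.
have s1 : all (leq 1) s by apply: sub_all sk => b /andP[].
have kL : (2 <= k.+1 * L)%N by nia.
rewrite run_cons /= k1 sk; split=> //.
- exact: tree_bounds sT.
- case/lastP: s sk {sT s1} => [|s b]; first by move=> _; rewrite /=; lia.

  rewrite all_rcons run_rcons => /andP[/= bk sk].
  have s1 : all (leq 1) s by apply: sub_all sk => c /andP[].
  have := run_decr s (2, 1)%N s1 isT; rewrite -[(2 * 1 + 0)%N]/2%N.
  case: (run s _) => q q' /= qq'.
  have : (b * q <= k * q)%N by rewrite leq_mul2r; lia.
  by lia.
- exact: run_decr.
Qed.

Lemma words_inj k L v w : v \in words k L -> w \in words k L ->
  run v (1, 0)%N = run w (1, 0)%N -> v = w.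
Proof.
have L1 s : s \in tree k L (up_log 2 (2 * L ^ 2)%N) (2, 1)%N -> all (leq 1) s.
  by move/tree_letters; apply: sub_all => b /andP[].
move=> /mapP[s sT ->] /mapP[r rT ->]; rewrite !run_cons /= => E.
by congr cons; apply: run_inj E; apply: L1.
Qed.

(** In powers of t, the loss in [tree_size] amounts to less than one factor t, which makes all
    exponents integers. *)
Lemma words_size k m t e : (0 < e)%N -> (4 * e <= m)%N -> (4 * m <= k)%N ->
  (144 < t)%N -> (t ^ (2 * e).-1 <= size (words k (t ^ e)))%N.
Proof.
move=> e0 em mk t144; rewrite size_map; set L := (t ^ e)%N.
have L0 : (0 < L)%N by rewrite expn_gt0; lia.
have L2 : (1 < 2 * L ^ 2)%N by nia.
set n := up_log _ _.
have n1 : (2 * L ^ 2 <= 2 ^ n)%N by apply: up_logP.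
have n2 : (2 ^ n <= 4 * L ^ 2)%N.
  have /andP[+ _] := up_log_bounds (isT : 1 < 2)%N L2.
  have n0 : (0 < n)%N by rewrite up_log_gt0.
  by rewrite -/n => lt; have -> : (2 ^ n = 2 * 2 ^ n.-1)%N; [rewrite -expnS prednK|lia].
have m0 : (0 < m)%N by lia.
have := tree_size k m L n m0 mk L0; rewrite n1 n2 => /(_ isT).
set S := size _ => H; rewrite leqNgt; apply/negP => lt.
have {lt} lt : (t * S <= L ^ 2)%N.
  rewrite /L -expnM -[X in (_ <= t ^ X)%N](@prednK (e * 2)) ?expnS; last by lia.
  by rewrite leq_mul2l mulnC (ltnW lt) orbT.
have := leq_mul (leqnn (t ^ m)) H.
have -> : (t ^ m * ((6 * S) ^ m * (4 * L ^ 2)) =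
           (t * S) ^ m * (6 ^ m * (4 * L ^ 2)))%N.
  by rewrite !expnMn; ring.
have lt' : ((t * S) ^ m <= L ^ (2 * m))%N by rewrite expnM leq_exp2r.
move/leq_trans/(_ (leq_mul lt' (leqnn _))).
rewrite mulnC leq_mul2l expn_eq0 (gtn_eqF L0) /= leqNgt => /negP; apply.
have -> : (t ^ m = t ^ (m - 2 * e) * L ^ 2)%N.
  by rewrite /L -expnM -expnD; congr expn; lia.
rewrite mulnA ltn_mul2r expn_gt0 L0 /=.
(* Here 144 = 36 * 4: as m <= 2 (m - 2 e), the powers of 36 absorb 6^m, and those of 4 absorb the
   remaining factor 4. *)
have j0 : (0 < m - 2 * e)%N by lia.
have le6 : (6 ^ m <= 36 ^ (m - 2 * e))%N.
  by rewrite -[36%N]/(6 ^ 2)%N -expnM leq_exp2l //; lia.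
apply: (@leq_trans (145 ^ (m - 2 * e))); last by rewrite leq_exp2r.
apply: (@leq_trans (144 ^ (m - 2 * e)).+1); last by rewrite ltn_exp2r.
rewrite ltnS -[144%N]/(36 * 4)%N expnMn leq_mul //.
by rewrite -[X in (X <= _)%N]expn1 leq_exp2l.
Qed.

(** * A second moment over matrices of given determinant *)

Definition mat2_det {F : pzRingType} (g : F * F * F * F) : F :=
  g.1.1.1 * g.2 - g.1.1.2 * g.1.2.

Definition mat2_form {F : pzRingType} (g : F * F * F * F) (x y : F) : F :=
  g.1.1.1 + g.1.1.2 * y + g.1.2 * x + g.2 * x * y.

Section SecondMoment.
Variables (F : finFieldType) (s : F) (s0 : s != 0).

Definition det_level : {set F * F * F * F} := [set g | mat2_det g == s].

Definition det_zeros (x y : F) : {set F * F * F * F} :=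
  [set g in det_level | mat2_form g x y == 0].

(* In terms of u = b + d x and v = c + d y, a matrix with det g = s and
   mat2_form g x y = 0 is one with u v = - s. *)
Let mk (x y : F) (u : F * F) : F * F * F * F :=
  (- u.1 * y + s / u.1 * x + u.2 * x * y, u.1 - u.2 * x,
   - (s / u.1) - u.2 * y, u.2).

Lemma det_zerosE x y :
  det_zeros x y = mk x y @: setX [set~ 0] [set: F].
Proof.
apply/setP => g; apply/idP/imsetP => [|[[u v]]]; last first.
  rewrite !inE andbT /= => u0 ->; rewrite /mat2_det /mat2_form /=.
  by apply/andP; split; apply/eqP; field.
case: g => [[[a b] c] d]; rewrite !inE /mat2_det /mat2_form /=.
case/andP => /eqP e1 /eqP e2.
have e3 : (b + d * x) * (c + d * y) = - s.
  by rewrite -e1 -[RHS]addr0 -(mulr0 d) -e2; ring.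
have b0 : b + d * x != 0.
  by apply: contraNneq s0 => bz; rewrite -oppr_eq0 -e3 bz mul0r.
exists (b + d * x, d); first by rewrite !inE b0.
have cE : c = - (s / (b + d * x)) - d * y.
  by rewrite -[s]opprK -e3; field.
rewrite /mk /=; congr (_, _, _, _) => //; last by ring.
  rewrite -[LHS]subr0 -e2 [in LHS]cE.
  by ring.
Qed.

Lemma card_det_zeros x y : #|det_zeros x y| = (#|F|.-1 * #|F|)%N.
Proof.
rewrite det_zerosE card_in_imset => [|[u v] [u' v'] _ _ /= []].
  by rewrite cardsX cardsC1 cardsT.
by move=> _ + _ e; rewrite e => /addIr ->.
Qed.

(** In the coordinates u = b + d x and d, the second equation is linear in d with coefficient (x' -
    x) (y' - y). So u determines d, and if one difference vanishes there is no solution. *)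
Lemma card_det_zerosI x y x' y' : (x, y) != (x', y') ->
  (#|det_zeros x y :&: det_zeros x' y'| <= #|F|)%N.
Proof.
move=> ne; rewrite -[X in (_ <= X)%N]cardsT.
pose f (g : F * F * F * F) := g.1.1.2 + g.2 * x.
rewrite -(@card_in_imset _ _ f (mem (det_zeros x y :&: det_zeros x' y'))).
  exact: subset_leq_card (subsetT _).
have P g : g \in det_zeros x y :&: det_zeros x' y' ->
    exists u v, [/\ u != 0, g = mk x y (u, v) & mat2_form g x' y' = 0].
  case/setIP; rewrite {1}det_zerosE => /imsetP[[u v]].
  rewrite !inE andbT /= => u0 -> /andP[_ /eqP e].
  by exists u, v.
move=> g h /P[u [v [u0 -> e1]]] /P[u' [v' [_ -> e2]]]; move: e1 e2.
rewrite /f /= !subrK => e1 e2 uu; subst u'; move: e1 e2.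
have e w : mat2_form (mk x y (u, w)) x' y' = u * (y' - y) - s / u * (x' - x)
    + w * (x' - x) * (y' - y) by rewrite /mat2_form /=; ring.
rewrite !e.
have [xx|xn] := eqVneq x' x.
  subst x'; rewrite subrr !mulr0 !mul0r subr0 addr0 => /eqP.
  rewrite mulf_eq0 (negPf u0) subr_eq0 /= => /eqP yy.
  by rewrite yy eqxx in ne.
have [yy|yn] := eqVneq y' y.
  subst y'; rewrite subrr !mulr0 addr0 sub0r => /eqP.
  by rewrite oppr_eq0 !mulf_eq0 invr_eq0 subr_eq0 (negPf u0) (negPf s0) (negPf xn).
move=> e1 e2; congr (mk _ _ (_, _)).
have : (v - v') * (x' - x) * (y' - y) = 0.
  by rewrite -[RHS](subrr 0) -{1}e1 -e2; ring.
by move/eqP; rewrite !mulf_eq0 !subr_eq0 (negPf xn) (negPf yn) !orbF => /eqP.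
Qed.

(** If a != 0, then d is determined by a, b, c; if a = 0, then b != 0 and c is determined by b and
    s. *)
Lemma card_det_level : (#|det_level| <= #|F| ^ 3)%N.
Proof.
pose f (g : F * F * F * F) : F * F * F :=
  if g.1.1.1 == 0 then (0, g.1.1.2, g.2) else (g.1.1.1, g.1.1.2, g.1.2).
rewrite !expnS muln1 mulnA -2!card_prod -[X in (_ <= X)%N]cardsT.
rewrite -(@card_in_imset _ _ f (mem det_level)).
  exact: subset_leq_card (subsetT _).
move=> [[[a b] c] d] [[[a' b'] c'] d']; rewrite !inE /mat2_det /f /=.
move=> /eqP e1 /eqP e2.
have [az|a0] := eqVneq a 0; have [az'|a0'] := eqVneq a' 0.
- case=> bb dd; subst; congr (_, _, _, _).
  have b0 : b' != 0 by apply: contraNneq s0 => ->; rewrite !mul0r subrr.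
  apply: (mulfI b0); apply: oppr_inj.
  by rewrite -[LHS]add0r -[RHS]add0r -[in LHS](mul0r d') -[in RHS](mul0r d').
- by case=> E; rewrite -E eqxx in a0'.
- by case=> E; rewrite E eqxx in a0.
case=> aa bb cc; subst; congr (_, _, _, _); apply: (mulfI a0').
by apply: (addIr (- (b' * c'))).
Qed.

(** Chebyshev's inequality for the number [Z g] of zeros of the form of g in X x Y, whose mean is
    about n / q. *)
Lemma few_missing (X Y : {set F}) :
  (#|[set g in det_level |
       [forall x in X, forall y in Y, mat2_form g x y != 0%R]]|
     * (#|X| * #|Y|) <= 3 * #|F| ^ 4)%N.
Proof.
set B := [set g in _ | _]; set n := (#|X| * #|Y|)%N; set q := #|F|.
pose Z g : int := \sum_(u in setX X Y) (mat2_form g u.1 u.2 == 0)%:R.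
have nE : \sum_(u in setX X Y) (1 : int) = n%:R by rewrite sumr_const cardsX.
have S1 : \sum_(g in det_level) Z g = (n * (q.-1 * q))%N%:R.
  rewrite exchange_big /= natrM -nE mulr_suml; apply: eq_bigr => u _.
  rewrite mul1r -(card_det_zeros u.1 u.2) -sum1_card natr_sum.
  rewrite [RHS](eq_bigl (fun g => (g \in det_level) && (mat2_form g u.1 u.2 == 0))).
    by rewrite big_mkcondr; apply: eq_bigr => g _; case: ifP.
  by move=> g; rewrite inE.
have S2 : \sum_(g in det_level) Z g ^+ 2 <= (n * (q.-1 * q) + n ^ 2 * q)%N%:R.
  pose W := setX X Y; have nW : #|W| = n by rewrite cardsX.
  have -> : \sum_(g in det_level) Z g ^+ 2 = \sum_(u in W) \sum_(v in W)
      #|det_zeros u.1 u.2 :&: det_zeros v.1 v.2|%:R.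
    under eq_bigr do rewrite expr2 mulr_suml.
    rewrite exchange_big; apply: eq_bigr => u _.
    under eq_bigr do rewrite mulr_sumr.
    rewrite exchange_big; apply: eq_bigr => v _ /=.
    rewrite -sum1_card natr_sum.
    rewrite [RHS](eq_bigl (fun g => (g \in det_level)
      && ((mat2_form g u.1 u.2 == 0) && (mat2_form g v.1 v.2 == 0)))).
      rewrite [RHS]big_mkcondr; apply: eq_bigr => g _.
      by do 2 case: (_ == _).
    by move=> g; rewrite !inE andbACA andbb.
  apply: (@le_trans _ _ (\sum_(u in W) \sum_(v in W)
      ((u == v)%:R * (q.-1 * q)%:R + q%:R))).
    apply: ler_sum => -[x y] uW; apply: ler_sum => -[x' y'] vW /=.
    have [[-> ->]|ne] := eqVneq; last by rewrite mul0r add0r ler_nat card_det_zerosI.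
    by rewrite setIid card_det_zeros mul1r lerDl ler0n.
  rewrite (eq_bigr (fun u => (q.-1 * q)%:R + n%:R * q%:R)) => [|u uW].
    by rewrite sumr_const nW -[X in X <= _]mulr_natl -natrM -natrD -natrM
      ler_nat mulnDr (mulnA n n) mulnn.
  rewrite big_split /= sumr_const nW; congr (_ + _); last by rewrite mulr_natl.
  rewrite (bigD1 u) //= eqxx mul1r big1 ?addr0 // => v /andP[_].
  by rewrite eq_sym => /negPf ->; rewrite mul0r.
(* Matrices in [B] have Z = 0 and contribute n^2 each. Scaling Z by q keeps the deviation
   integral. *)
have SB : #|B|%:R * n%:R ^+ 2 <= \sum_(g in det_level) (q%:R * Z g - n%:R) ^+ 2.
  rewrite (bigID (mem B)) /=.
  rewrite -[X in X <= _]addr0 lerD //; last by apply: sumr_ge0 => g _; rewrite sqr_ge0.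
  rewrite (eq_bigl (mem B)); last first.
    move=> g /=; rewrite andbC; case: (boolP (g \in B)) => //.
    by rewrite inE => /andP[->].
  rewrite mulr_natl -sumr_const; apply: ler_sum => g.
  rewrite inE => /andP[_ /forall_inP gB].
  suff -> : Z g = 0 by rewrite mulr0 sub0r sqrrN.
  rewrite /Z big1 // => -[x y]; rewrite inE => /andP[/= xX yY].
  by move/forall_inP: (gB x xX) => /(_ y yY) /negPf ->.
have q0 : (1 < q)%N by apply: card_finNzRing_gt1.
have nq : (n <= q ^ 2)%N by rewrite expnS expn1 leq_mul ?max_card.
have {}SB : #|B|%:R * n%:R ^+ 2 <= q%:R ^+ 2 * (n * (q.-1 * q) + n ^ 2 * q)%:R
    - 2 * q%:R * n%:R * (n * (q.-1 * q))%:R + (q ^ 3)%:R * n%:R ^+ 2 :> int.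
  apply: (le_trans SB).
  have -> : \sum_(g in det_level) (q%:R * Z g - n%:R) ^+ 2 =
      q%:R ^+ 2 * (\sum_(g in det_level) Z g ^+ 2)
      - 2 * q%:R * n%:R * (\sum_(g in det_level) Z g) + #|det_level|%:R * n%:R ^+ 2.
    rewrite [LHS](eq_bigr (fun g => q%:R ^+ 2 * Z g ^+ 2 - 2 * q%:R * n%:R * Z g
      + n%:R ^+ 2)) => [|g _]; last by ring.
    by rewrite big_split sumrB /= sumr_const -!mulr_sumr -[X in _ + X = _]mulr_natl.
  rewrite S1; apply: lerD; last first.
    by apply: ler_wpM2r; rewrite ?sqr_ge0 // ler_nat card_det_level.
  by rewrite lerD2r; apply: ler_wpM2l => //; rewrite sqr_ge0.
have [->|n0] := posnP n; first by rewrite muln0.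
clearbody n q; move: #|B| SB => b SB {S1 S2 nE}.
have qE : q%:R = q.-1%:R + 1 :> int by rewrite natr1 prednK // ltnW.
have : (b * n ^ 2 <= (3 * q ^ 4) * n)%N.
  (* The terms q^3 n^2 cancel; n <= q^2 bounds what is left. *)
  apply: (@leq_trans (q ^ 3 * q.-1 * n + 2 * (q ^ 2 * n ^ 2))).
    rewrite -(ler_nat int) natrM natrX; apply: (le_trans SB).
    rewrite !(natrX, natrM, natrD) qE; set R := q.-1%:R; set N := n%:R.
    by rewrite le_eqVlt; apply/orP; left; apply/eqP; ring.
  have : (q ^ 2 * n ^ 2 <= q ^ 4 * n)%N.
    rewrite -[4%N]/(2 + 2)%N expnD -mulnA leq_mul2l -[X in (X <= _)%N]mulnn.
    by rewrite leq_mul2r nq !orbT.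
  have : (q ^ 3 * q.-1 * n <= q ^ 4 * n)%N.
    by rewrite leq_mul2r (expnSr q 3) leq_mul2l leq_pred !orbT.
  by rewrite -(mulnA 3); lia.
by rewrite expnS expn1 mulnA leq_pmul2r.
Qed.
End SecondMoment.

(** * Matrices congruent mod p *)

Lemma words_rows k L w : w \in words k L ->
  ((run w (0, 1)%N).1 <= (run w (1, 0)%N).1)%N /\
  ((run w (0, 1)%N).2 <= (run w (1, 0)%N).2)%N.
Proof. by case/mapP => s _ ->; rewrite !run_cons; apply: run_le. Qed.

(** The two sides differ by c1 a1 times the difference of the two determinants divided by p. *)
Lemma collision_factor (p s a1 a2 a3 a4 c1 c2 c3 c4 : int) : p != 0 ->
  a1 * a4 - a2 * a3 = s ->
  (a1 + p * c1) * (a4 + p * c4) - (a2 + p * c2) * (a3 + p * c3) = s ->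
  (c1 * a2 - a1 * c2) * (c1 * a3 - a1 * c3)
    = - (s * c1 ^+ 2 + (c1 * c4 - c2 * c3) * (a1 * (a1 + p * c1))).
Proof.
move=> p0 <- /eqP; rewrite -subr_eq0 => /eqP e.
apply: (mulfI p0); apply: subr0_eq; rewrite -[RHS](mulr0 (c1 * a1)) -e.
ring.
Qed.

Lemma size_flatten_le (T U : eqType) (f : T -> seq U) (Y : seq T) b :
  (forall y, y \in Y -> (size (f y) <= b)%N) ->
  (size (flatten [seq f y | y <- Y]) <= size Y * b)%N.
Proof.
elim: Y => [|y Y IH] H //=; rewrite size_cat mulSn leq_add ?H ?inE ?eqxx //.
by apply: IH => z zY; apply: H; rewrite inE zY orbT.
Qed.

Definition int_divisors (n : int) : seq int :=
  map Posz (divisors `|n|) ++ [seq - d%:Z | d <- divisors `|n|].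

Lemma int_divisorsP (u v n : int) : n != 0 -> u * v = n -> u \in int_divisors n.
Proof.
move=> n0 e; have un : (`|u| %| `|n|)%N by rewrite -e abszM dvdn_mulr.
have {un} ud : `|u|%N \in divisors `|n| by rewrite -dvdn_divisors ?absz_gt0.
rewrite mem_cat; apply/orP; have [u0|u0] := leP 0 u; [left|right].
  by apply/mapP; exists `|u|%N => //; lia.
by apply/mapP; exists `|u|%N => //; lia.
Qed.

Lemma mem_pairs (S T : eqType) (l : seq S) (r : seq T) (z : S * T) :
  (z \in [seq (x, y) | x <- l, y <- r]) = (z.1 \in l) && (z.2 \in r).
Proof.
case: z => x y; apply/allpairsPdep/andP => /= [[a [b [al br [-> ->]]]] //|[xl yr]].
by exists x, y.
Qed.

Lemma disc_le (p K N : nat) (s c1 c2 c3 c4 x : int) : `|s| = 1 ->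
  `|c1| <= K%:Z -> `|c2| <= K%:Z -> `|c3| <= K%:Z -> `|c4| <= K%:Z ->
  `|x| <= N%:Z ->
  (absz (s * c1 ^+ 2 + (c1 * c4 - c2 * c3) * (x * (x + p%:Z * c1)))%R
    <= K ^ 2 + 2 * K ^ 2 * (N * (N + p * K)))%N.
Proof.
move=> s1 c1K c2K c3K c4K xN.
have cc (c c' : int) : `|c| <= K%:Z -> `|c'| <= K%:Z -> `|c * c'| <= K%:Z ^+ 2.
  by move=> cK cK'; rewrite normrM expr2 ler_pM.
have dK : `|c1 * c4 - c2 * c3| <= 2 * K%:Z ^+ 2.
  by apply: le_trans (ler_normB _ _) _; rewrite mulr_natl mulr2n lerD // cc.
have xK : `|x + p%:Z * c1| <= N%:Z + p%:Z * K%:Z.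
  by apply: le_trans (ler_normD _ _) _; rewrite lerD // normrM ler_pM.
have c1K2 : `|s * c1 ^+ 2| <= K%:Z ^+ 2 by rewrite normrM s1 mul1r cc.
have dxK : `|(c1 * c4 - c2 * c3) * (x * (x + p%:Z * c1))|
    <= 2 * K%:Z ^+ 2 * (N%:Z * (N%:Z + p%:Z * K%:Z)).
  by rewrite normrM ler_pM // normrM ler_pM.
have := le_trans (ler_normD _ _) (lerD c1K2 dxK).
rewrite -lez_nat abszE => /le_trans; apply.
by rewrite le_eqVlt; apply/orP; left; apply/eqP; ring.
Qed.

(* For given c, a1 and s the first row is determined by the divisor
   c1 a2 - a1 c2 in collision_factor; the lower bounds K < a1 and
   K < a1 + p c1 keep the number to be divided from being 0. *)
Lemma collision_list (p K N B : nat) :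
  (forall n, (n <= K ^ 2 + 2 * K ^ 2 * (N * (N + p * K)))%N ->
     (size (divisors n) <= B)%N) ->
  exists S : seq (int * int),
    (size S <= 4 * (2 * K).+1 ^ 4 * N.+1 * B)%N /\
    forall s a1 a2 a3 a4 c1 c2 c3 c4 : int,
      `|s| = 1 -> (p != 0)%N -> K%:Z < a1 <= N%:Z -> K%:Z < a1 + p%:Z * c1 ->
      `|c1| <= K%:Z -> `|c2| <= K%:Z -> `|c3| <= K%:Z -> `|c4| <= K%:Z -> c1 != 0 ->
      a1 * a4 - a2 * a3 = s ->
      (a1 + p%:Z * c1) * (a4 + p%:Z * c4) - (a2 + p%:Z * c2) * (a3 + p%:Z * c3) = s ->
      (a1, a2) \in S.
Proof.
move=> HB.
pose rng : seq int := [seq i%:Z - K%:Z | i <- iota 0 (2 * K).+1].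
have rngP c : (c \in rng) = (`|c| <= K%:Z).
  apply/mapP/idP => [[i + ->]|cK]; first by rewrite mem_iota; lia.
  by exists (absz (c + K%:Z)); rewrite ?mem_iota; lia.
pose xs : seq int := [seq i%:Z | i <- iota 0 N.+1].
have xsP x : (x \in xs) = (0 <= x <= N%:Z).
  apply/mapP/idP => [[i + ->]|xN]; first by rewrite mem_iota; lia.
  by exists (absz x); rewrite ?mem_iota; lia.
pose Y := [seq (y, x) | y <- [seq (y, c) | y <- [seq (y, c) | y <- [seq (y, c) |
  y <- [seq (s, c) | s <- [:: 1 : int; -1], c <- rng], c <- rng], c <- rng], c <- rng],
  x <- xs].
pose disc (y : int * int * int * int * int * int) : int :=
  let: (s, c1, c2, c3, c4, x) := y in
  s * c1 ^+ 2 + (c1 * c4 - c2 * c3) * (x * (x + p%:Z * c1)).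
(* Solves u = c1 a2 - a1 c2 for a2. *)
pose pair_of (y : int * int * int * int * int * int) (u : int) : int * int :=
  let: (s, c1, c2, c3, c4, x) := y in (x, ((u + x * c2) %/ c1)%Z).
exists (flatten [seq [seq pair_of y u | u <- int_divisors (disc y)] | y <- Y]); split.
  (* The factor 4 counts two values of s and two signs of each divisor. *)
  have -> : (4 * (2 * K).+1 ^ 4 * N.+1 * B = size Y * (B + B))%N.
    by rewrite /Y !size_allpairs !size_map !size_iota /=; ring.
  apply: size_flatten_le => y yY.
  suff dB : (size (divisors `|disc y|) <= B)%N.
    by rewrite size_map size_cat !size_map leq_add.
  apply: HB; case: y yY => [[[[[s c1] c2] c3] c4] x].
  rewrite !mem_pairs /= !rngP xsP => /andP[/andP[/andP[/andP[/andP[sE c1K] c2K] c3K] c4K] xN].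
  have s1 : `|s| = 1 by move: sE; rewrite !inE => /orP[] /eqP ->.
  by apply: disc_le => //; lia.
move=> s a1 a2 a3 a4 c1 c2 c3 c4 s1 p0 a1N b1 c1K c2K c3K c4K c10 e1 e2.
apply/flatten_mapP; exists (s, c1, c2, c3, c4, a1).
  rewrite !mem_pairs /= !rngP xsP c1K c2K c3K c4K !andbT; apply/andP; split.
    by rewrite !inE; lia.
  by lia.
have p0' : p%:Z != 0 by [].
have e := collision_factor _ _ _ _ _ _ _ _ _ _ p0' e1 e2.
apply/mapP; exists (c1 * a2 - a1 * c2); last first.
  by rewrite /pair_of subrK mulrC mulzK.
apply: (int_divisorsP _ (- (c1 * a3 - a1 * c3))); last by rewrite mulrN e opprK.
rewrite /disc; set D := c1 * c4 - c2 * c3.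
have [->|D0] := eqVneq D 0.
  rewrite mul0r addr0 mulf_neq0 ?expf_neq0 //.
  by rewrite -normr_eq0 s1.
apply/eqP => z.
have : `|D * (a1 * (a1 + p%:Z * c1))| = `|c1| ^+ 2.
  have -> : D * (a1 * (a1 + p%:Z * c1)) = - (s * c1 ^+ 2) by rewrite -[RHS]addr0 -z; ring.
  by rewrite normrN normrM s1 mul1r normrX.
apply/eqP; rewrite gt_eqF //.
have D1 : 1 <= `|D| by lia.
apply: (@lt_le_trans _ _ (1 * `|a1 * (a1 + p%:Z * c1)|)); last first.
  by rewrite [X in _ <= X]normrM ler_wpM2r.
rewrite mul1r normrM expr2 ltr_pM //; lia.
Qed.

Lemma eqmod_int p K N x y : (0 < p)%N -> (N <= p * K)%N -> (x <= N)%N -> (y <= N)%N ->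
  x = y %[mod p] -> exists2 c : int, y%:Z = x%:Z + p%:Z * c & `|c| <= K%:Z.
Proof.
move=> p0 NK xN yN e.
have /dvdzP[c ce] : (p%:Z %| y%:Z - x%:Z)%Z.
  by rewrite -eqz_mod_dvd !modz_nat e.
exists c; first by rewrite mulrC -ce; ring.
have : `|c| * p%:Z <= K%:Z * p%:Z.
  by rewrite -[p%:Z in X in X <= _]gez0_abs // -normrM -ce; lia.
by rewrite ler_pM2r.
Qed.

Lemma sign_mod (p m n : nat) (z : int) : (2 < p)%N ->
  (-1) ^+ n - (-1) ^+ m = p%:Z * z :> int -> (-1) ^+ m = (-1) ^+ n :> int.
Proof.
move=> p2; rewrite -(signr_odd _ m) -(signr_odd _ n) => pz.
have : p%:Z * `|z| <= 2.
  rewrite -[p%:Z]gez0_abs // -normrM -pz.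
  by case: (odd m); case: (odd n); rewrite ?expr0 ?expr1.
have [z0 _|z0] := eqVneq z 0; first by move: pz; rewrite z0 mulr0; lia.
have : p%:Z * 1 <= p%:Z * `|z| by rewrite ler_wpM2l //; lia.
by lia.
Qed.

(** Words whose first row, in either order of its entries, lies in the list of [collision_list] are
    discarded; the two orders double the constant 4 to 8. *)
Lemma noncolliding (p K N B : nat) (A : seq (seq nat)) :
  (2 < p)%N -> (N <= p * K)%N ->
  (forall n, (n <= K ^ 2 + 2 * K ^ 2 * (N * (N + p * K)))%N ->
     (size (divisors n) <= B)%N) ->
  uniq A ->
  {in A, forall w, [/\ (K < (run w (1, 0)%N).2)%N,
      ((run w (1, 0)%N).2 <= (run w (1, 0)%N).1 <= N)%N,
      ((run w (0, 1)%N).1 <= N)%N & ((run w (0, 1)%N).2 <= N)%N]} ->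
  {in A &, injective (fun w => run w (1, 0)%N)} ->
  exists A' : seq (seq nat),
    [/\ uniq A', {subset A' <= A},
       (size A <= size A' + 8 * (2 * K).+1 ^ 4 * N.+1 * B)%N &
       {in A' &, forall v w,
         (run v (1, 0)%N).1 = (run w (1, 0)%N).1 %[mod p] ->
         (run v (1, 0)%N).2 = (run w (1, 0)%N).2 %[mod p] ->
         (run v (0, 1)%N).1 = (run w (0, 1)%N).1 %[mod p] ->
         (run v (0, 1)%N).2 = (run w (0, 1)%N).2 %[mod p] -> v = w}].
Proof.
move=> p2 NK HB uA bA injA.
have [S [sizeS SP]] := collision_list p K N B HB.
pose row w : int * int := ((run w (1, 0)%N).1%:Z, (run w (1, 0)%N).2%:Z).
(* If c1 = 0 the columns are exchanged; if c1 = c2 = 0 the rows agree. *)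
pose row' w : int * int := ((run w (1, 0)%N).2%:Z, (run w (1, 0)%N).1%:Z).
pose P w := row w \in S; pose P' w := row' w \in S.
exists [seq w <- A | ~~ (P w || P' w)]; split.
- exact: filter_uniq.
- by move=> w; rewrite mem_filter => /andP[].
- have cnt (f : seq nat -> int * int) : {in A &, injective f} ->
      (count (fun w => f w \in S) A <= size S)%N.
    move=> finj; rewrite -size_filter -(size_map f); apply: uniq_leq_size.
      rewrite map_inj_in_uniq ?filter_uniq // => v w.
      by rewrite !mem_filter => /andP[_ vA] /andP[_ wA]; apply: finj.
    by move=> y /mapP[w]; rewrite mem_filter => /andP[wS _] ->.
  have c1 : (count P A <= size S)%N.
    apply: cnt => v w vA wA [e1 e2]; apply: injA => //=.
    by apply/eqP; rewrite -pair_eqE /=; apply/andP; split; lia.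
  have c2 : (count P' A <= size S)%N.
    apply: cnt => v w vA wA [e1 e2]; apply: injA => //=.
    by apply/eqP; rewrite -pair_eqE /=; apply/andP; split; lia.
  have c3 : (count (predU P P') A <= count P A + count P' A)%N.
    by rewrite -count_predUI leq_addr.
  rewrite size_filter -(count_predC (predU P P')) addnC leq_add2l.
  apply: leq_trans c3 (leq_trans (leq_add c1 c2) _).
  apply: leq_trans (leq_add sizeS sizeS) _.
  by rewrite addnn -mul2n !mulnA.
move=> v w; rewrite !mem_filter negb_or => /andP[/andP[vP vP'] vA] /andP[_ wA].
have [v1 /andP[v2 v3] v4 v5] := bA v vA.
have [w1 /andP[w2 w3] w4 w5] := bA w wA.
have p0 : (0 < p)%N by lia.
move=> /(eqmod_int p K N _ _ p0 NK v3 w3)[c1 e1 k1].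
move=> /(eqmod_int p K N _ _ p0 NK (leq_trans v2 v3) (leq_trans w2 w3))[c2 e2 k2].
move=> /(eqmod_int p K N _ _ p0 NK v4 w4)[c3 e3 k3].
move=> /(eqmod_int p K N _ _ p0 NK v5 w5)[c4 e4 k4].
pose a1 := (run v (1, 0)%N).1%:Z; pose a2 := (run v (1, 0)%N).2%:Z.
pose a3 := (run v (0, 1)%N).1%:Z; pose a4 := (run v (0, 1)%N).2%:Z.
have dv := run_det v; have dw := run_det w.
have dvw : (-1) ^+ size v = (-1) ^+ size w :> int.
  (* The witness is the difference of the two determinants divided by p. *)
  apply: (sign_mod p _ _ (a1 * c4 + c1 * a4 + p%:Z * c1 * c4
    - a2 * c3 - c2 * a3 - p%:Z * c2 * c3) p2).
  by rewrite -dv -dw e1 e2 e3 e4 /a1 /a2 /a3 /a4; ring.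
have s1 n : `|(-1) ^+ n| = 1 :> int by rewrite normrX normrN1 expr1n.
rewrite -dvw e1 e2 e3 e4 in dw.
have pn0 : (p != 0)%N by lia.
have b1 : K%:Z < (run v (1, 0)%N).1%:Z <= N%:Z by lia.
have b2 : K%:Z < (run v (1, 0)%N).2%:Z <= N%:Z by lia.
have b1' : K%:Z < (run v (1, 0)%N).1%:Z + p%:Z * c1 by rewrite -e1; lia.
have b2' : K%:Z < (run v (1, 0)%N).2%:Z + p%:Z * c2 by rewrite -e2; lia.
have [c10|c10] := eqVneq c1 0; last first.
  by case/negP: vP; apply: (SP _ _ _ _ _ _ _ _ _ (s1 _) pn0 b1 b1' k1 k2 k3 k4 c10 dv dw).
have [c20|c20] := eqVneq c2 0; last first.
  (* Exchanging the columns negates the determinant. *)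
  case/negP: vP'; apply: (SP (- _) _ _ _ _ _ _ _ _ _ pn0 b2 b2' k2 k1 k4 k3 c20).
  - by rewrite normrN; apply: (s1 (size v)).
  - by rewrite -dv opprB.
  - by rewrite -dw opprB.
rewrite c10 c20 mulr0 !addr0 in e1 e2.
apply: injA => //=; apply/eqP; rewrite -pair_eqE /=.
by apply/andP; split; lia.
Qed.

(** * Denominators divisible by p *)

Lemma run_triple x a y :
  (run (x ++ a ++ rev y) (1, 0)%N).1 =
  ((run x (1, 0)).1 *
     ((run a (1, 0)).1 * (run y (1, 0)).1 + (run a (1, 0)).2 * (run y (1, 0)).2)
 + (run x (1, 0)).2 *
     ((run a (0, 1)).1 * (run y (1, 0)).1 + (run a (0, 1)).2 * (run y (1, 0)).2))%N.
Proof. by rewrite !run_cat run_rev (run_linear a) /=; ring. Qed.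

Lemma natr_Fp_eq p m n : prime p ->
  (m%:R == n%:R :> 'F_p) = (m == n %[mod p]).
Proof.
move=> pr; apply/eqP/eqP => [/(congr1 (@nat_of_ord _))|e]; first by rewrite !val_Fp_nat.
by apply: val_inj; rewrite /= !val_Fp_nat.
Qed.

Lemma coprime_cross a b c d : coprime a b -> coprime c d -> (0 < a)%N -> (0 < c)%N ->
  (b * c = d * a)%N -> a = c /\ b = d.
Proof.
move=> ab cd a0 c0 e.
have ac : (a %| c)%N by rewrite -(Gauss_dvdr _ ab) e dvdn_mull.
have ca : (c %| a)%N by rewrite -(Gauss_dvdr _ cd) -e dvdn_mull.
have ac' : a = c by apply/eqP; rewrite eqn_dvd ac ca.
by split=> //; apply/eqP; rewrite -(eqn_pmul2r a0) -e ac'.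
Qed.

(** The determinants of the middle words are 1 or -1, so [few_missing] leaves at most 6 p^4 / |X|^2
    bad residue matrices, fewer than the words of [A], whose residues are distinct. *)
Lemma denominator_divisible (p : nat) (A X : seq (seq nat)) : prime p ->
  uniq A -> uniq X ->
  {in A &, forall v w,
     (run v (1, 0)%N).1 = (run w (1, 0)%N).1 %[mod p] ->
     (run v (1, 0)%N).2 = (run w (1, 0)%N).2 %[mod p] ->
     (run v (0, 1)%N).1 = (run w (0, 1)%N).1 %[mod p] ->
     (run v (0, 1)%N).2 = (run w (0, 1)%N).2 %[mod p] -> v = w} ->
  {in X &, injective (fun w => run w (1, 0)%N)} ->
  {in X, forall w, (0 < (run w (1, 0)%N).2 < (run w (1, 0)%N).1)%N /\
                   ((run w (1, 0)%N).1 ^ 2 <= p)%N} ->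
  (6 * p ^ 4 < size A * size X ^ 2)%N ->
  exists x a y, [/\ x \in X, a \in A, y \in X &
    (p %| (run (x ++ a ++ rev y) (1, 0)%N).1)%N].
Proof.
move=> pr uA uX injA injX bX big.
pose res (n : nat) : 'F_p := n%:R.
pose xi w := res (run w (1, 0)%N).2 / res (run w (1, 0)%N).1.
pose phi w := (res (run w (1, 0)%N).1, res (run w (1, 0)%N).2,
               res (run w (0, 1)%N).1, res (run w (0, 1)%N).2).
have q0 w : w \in X -> res (run w (1, 0)%N).1 != 0.
  move=> /bX[lt qp]; rewrite /res -[0]/(0%:R) natr_Fp_eq // mod0n.
  have qp' : ((run w (1, 0)%N).1 < p)%N by have := prime_gt1 pr; nia.
  by rewrite modn_small //; lia.
have xi_inj : {in X &, injective xi}.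
  move=> v w vX wX e; apply: injX => //=.
  have [v1 v2] := bX v vX; have [w1 w2] := bX w wX.
  have := run_coprime_row v; have := run_coprime_row w.
  move: (q0 v vX) (q0 w wX) v1 v2 w1 w2 e; rewrite /xi.
  case: (run v _) => a b; case: (run w _) => c d /= a0 c0 ba a2 dc c2 e cd ab.
  have e' : res (b * c)%N = res (d * a)%N.
    have -> : res (b * c)%N = res b / res a * (res a * res c) by rewrite /res natrM; field.
    by rewrite e /res natrM; field.
  (* Denominators up to p^(1/2) keep both cross products below p, so equal ratios mod p are equal
     fractions. *)
  have bc : (b * c < p)%N by rewrite -!mulnn in a2 c2; have := leq_total a c; nia.
  have da : (d * a < p)%N by rewrite -!mulnn in a2 c2; have := leq_total a c; nia.
  move/eqP: e'; rewrite natr_Fp_eq // !modn_small // => /eqP e'.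
  have a1 : (0 < a)%N by lia.
  have c1 : (0 < c)%N by lia.
  by have [-> ->] := coprime_cross _ _ _ _ ab cd a1 c1 e'.
pose XF : {set 'F_p} := [set z in map xi X].
have cX : #|XF| = size X.
  by rewrite cardsE (card_uniqP _) ?size_map // map_inj_in_uniq.
pose bad (s : 'F_p) := [set g in det_level _ s |
   [forall x in XF, forall y in XF, mat2_form g x y != 0]].
have cF : #|'F_p| = p by exact: card_Fp.
have badle (s : 'F_p) : s != 0 -> (#|bad s| * size X ^ 2 <= 3 * p ^ 4)%N.
  by move=> s0; have := few_missing _ s s0 XF XF; rewrite cX cF mulnn.
have [w wA wbad] : exists2 w, w \in A & phi w \notin bad 1 :|: bad (-1).
  apply/hasP; rewrite -[has _ _]negbK -all_predC; apply/negP => /allP allbad.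
  have : (size A <= #|bad 1%R :|: bad (-1)%R|)%N.
    rewrite -(size_map phi) cardE; apply: uniq_leq_size.
      rewrite map_inj_in_uniq // => v w vA wA [/eqP e1 /eqP e2 /eqP e3 /eqP e4].
      by apply: injA => //; apply/eqP; rewrite -natr_Fp_eq.
    by move=> g /mapP[w wA ->]; rewrite mem_enum; have := allbad w wA; rewrite /= negbK.
  move=> sA; have := leq_trans sA (leq_card_setU _ _).
  have := badle 1 (oner_neq0 _); have := badle (-1) _.
  rewrite oppr_eq0 oner_neq0 => /(_ isT).
  by nia.
have dw : mat2_det (phi w) = (-1) ^+ size w.
  rewrite /mat2_det /= /res -!natrM.
  have := congr1 (fun z : int => z%:~R : 'F_p) (run_det w).
  by rewrite rmorphB !rmorphM /= rmorphXn rmorphN1 -!pmulrn.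
have : exists2 s, phi w \in det_level _ s & phi w \notin bad s.
  move: wbad; rewrite inE negb_or => /andP[b1 b2].
  exists ((-1) ^+ size w); first by rewrite inE dw.
  by rewrite -signr_odd; case: odd; rewrite ?expr0 ?expr1.
case=> s ws; rewrite inE ws /= negb_forall_in => /exists_inP[x xX].
rewrite negb_forall_in => /exists_inP[y yX]; rewrite negbK => /eqP form0.
move: xX yX form0; rewrite !inE => /mapP[u uM ->] /mapP[v vM ->] form0.
exists u, w, v; split=> //.
have -> : (p %| (run (u ++ w ++ rev v) (1, 0)%N).1)%N =
    (res (run (u ++ w ++ rev v) (1, 0)%N).1 == 0).
  by rewrite /res -[0]/(0%:R) natr_Fp_eq // mod0n.
rewrite run_triple /res !(natrD, natrM); apply/eqP.
have u0 := q0 u uM; have v0 := q0 v vM.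
rewrite -[RHS](mulr0 (res (run u (1, 0)%N).1 * res (run v (1, 0)%N).1)) -form0.
by rewrite /mat2_form /xi /= /res; field; apply/andP.
Qed.

(** * Choice of parameters and conclusion *)

Lemma nat_root_bracket d p : (0 < d)%N -> (0 < p)%N ->
  exists t, (t ^ d <= p < t.+1 ^ d)%N.
Proof.
move=> d0 p0; pose P t := (t ^ d <= p)%N.
have P0 : exists t, P t by exists 0%N; rewrite /P exp0n.
have Pb t : P t -> (t <= p)%N.
  move=> Pt; apply: leq_trans Pt; case: t => // t.
  by rewrite -[X in (X <= _)%N]expn1 leq_pexp2l.
case: (ex_maxnP P0 Pb) => t Pt tmax; exists t; rewrite [X in X && _]Pt /=.
by rewrite ltnNge; apply/negP => /tmax; rewrite ltnn.
Qed.

Lemma words_large_prime (g : nat) : (14 <= g)%N ->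
  exists k p0 : nat, (1 < k)%N /\ forall p : nat, prime p -> (p0 <= p)%N ->
    exists x a y : seq nat, exists LX LA,
      [/\ x \in words k LX /\ y \in words k LX, a \in words k LA,
          (0 < LX)%N && (0 < LA)%N,
          (p %| (run (x ++ a ++ rev y) (1, 0)%N).1)%N &
          ((run (x ++ a ++ rev y) (1, 0)%N).1 <= 4 * p ^ 3)%N].
Proof.
move=> g14; have [C HC] := size_divisors_bound.
have C1 : (0 < C)%N by have := HC 1%N 1%N isT; rewrite muln1.
(* As 3 divides h, the cube root in the divisor bound is a power of t. The values of m and k serve
   [words_size] with both exponents h - 1 and 2 h + 4. *)
pose h := (3 * g)%N; pose m := (4 * (2 * h + 4))%N; pose k := (4 * m)%N.
(* One summand for each lower bound on t needed below. *)
pose T := (145 + k.+1 + 2 ^ (2 * h) + 2592 * C + 13 * 2 ^ (8 * h))%N.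
exists k, (T ^ (2 * h))%N; split=> [|p pr pT]; first by rewrite /k /m; lia.
have p0 := prime_gt0 pr; have h0 : (0 < 2 * h)%N by rewrite /h; lia.
have [t /andP[tp pt]] := nat_root_bracket _ _ h0 p0.
have Tt : (T <= t)%N.
  by rewrite -ltnS -(ltn_exp2r _ _ h0) (leq_ltn_trans pT).
have t145 : (144 < t)%N by apply: leq_trans Tt; rewrite /T; lia.
have tk : (k.+1 <= t)%N by apply: leq_trans Tt; rewrite /T; lia.
have t2 : (2 ^ (2 * h) <= t)%N by apply: leq_trans Tt; rewrite /T; lia.
have tC : (2592 * C <= t)%N by apply: leq_trans Tt; rewrite /T; lia.
have t8 : (13 * 2 ^ (8 * h) <= t)%N by apply: leq_trans Tt; rewrite /T; lia.
have {}k1 : (1 < k)%N by rewrite /k /m; lia.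
have mX : (4 * h.-1 <= m)%N by rewrite /m; lia.
have mA : (4 * (2 * h + 4) <= m)%N by [].
have km : (4 * m <= k)%N by [].
have hg : h = (3 * g)%N by [].
have e6 : (4 * h - 6 = (2 * h.-1).-1 * 2)%N by lia.
have e7 : (4 * h + 7 + (4 * h - 6) = (8 * h).+1)%N by lia.
(* This forces g >= 14: it reads 10 g + 34 <= 12 g + 7 and leaves a factor t between the collisions
   and the words. *)
have e10 : ((20 + (2 * h + 5) + (4 * g + 8)).+1 <= 4 * h + 7)%N by rewrite /h; lia.
have e9 : (h + (2 * h + 5 + h) <= 2 * h * 3)%N by lia.
have e8 : (8 * h = 2 * h * 4)%N by lia.
have eA : ((2 * (2 * h + 4)).-1 = 4 * h + 7)%N by lia.
clearbody T k m h; clear T Tt pT.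
have t0 : (0 < t)%N by lia.
have pt2 : (p <= 2 ^ (2 * h) * t ^ (2 * h))%N.
  by rewrite -expnMn (leq_trans (ltnW pt)) // leq_exp2r //; lia.
have pow i j : (i <= j)%N -> (t ^ i <= t ^ j)%N by move=> ij; rewrite leq_pexp2l.
have tpos i : (0 < t ^ i)%N by rewrite expn_gt0 t0.
(* p is about t^(2h); the two outer words have denominators of order p^(1/2) / t
   and the middle one of order p t^4. *)
pose LX := (t ^ h.-1)%N; pose LA := (t ^ (2 * h + 4))%N.
pose K := (t ^ 5)%N; pose N := (t ^ (2 * h + 5))%N.
pose B := (C * t ^ (4 * g + 8))%N.
have h1 : (0 < h.-1)%N by lia.
have sX := words_size k m t h.-1 h1 mX km t145; rewrite -/LX in sX.
have sA := words_size k m t (2 * h + 4)%N ltac:(lia) mA km t145; rewrite -/LA in sA.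
have LX0 : (0 < LX)%N := tpos _.
have LA0 : (0 < LA)%N := tpos _.
have hpos : (0 < h)%N by lia.
have kLX : (k.+1 * LX <= t ^ h)%N.
  by rewrite -[X in (_ <= _ ^ X)%N](prednK hpos) expnS leq_mul2r tk orbT.
have kLA : (k.+1 * LA <= N)%N.
  by rewrite /N (addnS _ 4) expnS leq_mul.
have NK : (N <= p * K)%N by rewrite /N expnD leq_mul2r tp orbT.
have pK : (p * K <= t ^ (2 * h + 6))%N.
  apply: (@leq_trans (2 ^ (2 * h) * t ^ (2 * h) * K)); first by rewrite leq_mul2r pt2 orbT.
  by rewrite -mulnA -expnD (addnS _ 5) expnS leq_mul2r t2 orbT.
have HB n : (n <= K ^ 2 + 2 * K ^ 2 * (N * (N + p * K)))%N -> (size (divisors n) <= B)%N.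
  have [->|n0] := posnP n.
    (* By convention [divisors 0] has one entry, so [B] only has to be positive. *)
    move=> _; rewrite (_ : size (divisors 0) = 1%N) //.
    by rewrite /B muln_gt0 C1 tpos.
  move=> nM; apply: HC; rewrite n0 /=; apply: leq_trans nM _.
  (* Here 4 h + 22 = 12 g + 22 <= 3 (4 g + 8), which explains the exponent in [B]. *)
  apply: (@leq_trans (t ^ (4 * h + 22))); last by rewrite -expnM pow //; lia.
  have l1 : (N + p * K <= 2 * t ^ (2 * h + 6))%N.
    by rewrite mul2n -addnn leq_add // /N pow //; lia.
  have l2 : (K ^ 2 <= t ^ (4 * h + 21))%N by rewrite /K -expnM pow //; lia.
  have l3 : (2 * K ^ 2 * (N * (N + p * K)) <= 4 * t ^ (4 * h + 21))%N.
    have -> : (4 * t ^ (4 * h + 21) = 2 * K ^ 2 * (N * (2 * t ^ (2 * h + 6))))%N.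
      have -> : (4 * h + 21 = 5 * 2 + (2 * h + 5) + (2 * h + 6))%N by lia.
      by rewrite /K /N -expnM (expnD _ (_ + _)) (expnD _ (5 * 2)); ring.
    by rewrite leq_mul2l leq_mul2l l1 !orbT.
  rewrite (addnS _ 21) [X in (_ <= X)%N]expnS.
  have l5 : (5 * t ^ (4 * h + 21) <= t * t ^ (4 * h + 21))%N.
    by rewrite leq_mul2r; apply/orP; right; lia.
  by apply: (leq_trans _ l5); rewrite -[5%N]/(4.+1)%N mulSn leq_add.
have wbA : {in words k LA, forall w, [/\ (K < (run w (1, 0)%N).2)%N,
      ((run w (1, 0)%N).2 <= (run w (1, 0)%N).1 <= N)%N,
      ((run w (0, 1)%N).1 <= N)%N & ((run w (0, 1)%N).2 <= N)%N]}.
  move=> w wA; have [_ _ /andP[q1 q2] q3 /andP[q4 q5]] := wordsP k LA w LA0 k1 wA.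
  have [r1 r2] := words_rows k LA w wA.
  have qN := leq_trans q2 kLA; split.
  (* Otherwise t^(2 h + 4) <= q <= (k + 1) q' <= t^6. *)
  - rewrite ltnNge; apply/negP => qK.
    have : (t * t ^ (2 * h + 3) <= t * t ^ 5)%N.
      rewrite -expnS -addnS; apply: leq_trans q1 (leq_trans q3 _).
      by rewrite leq_mul.
    by rewrite leq_pmul2l // leq_exp2l; lia.
  - by rewrite (ltnW q5).
  - exact: leq_trans r1 qN.
  - exact: leq_trans r2 (leq_trans (ltnW q5) qN).
have p2 : (2 < p)%N.
  apply: leq_trans tp; apply: leq_trans (pow 1%N _ _); [by rewrite expn1; lia|lia].
have [A [uA AW sizeA injA]] := noncolliding p K N B _ p2 NK HB (words_uniq k LA) wbA
  (words_inj k LA).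
(* At least half of the middle words survive; 2592 = 2 * 8 * 81 * 2. *)
have coll : (2 * (8 * (2 * K).+1 ^ 4 * N.+1 * B) <= t ^ (4 * h + 7))%N.
  have l1 : ((2 * K).+1 ^ 4 <= 81 * t ^ 20)%N.
    rewrite (_ : 81 * t ^ 20 = (3 * K) ^ 4)%N ?leq_exp2r //.
      by have := tpos 5; rewrite -/K; lia.
    by rewrite /K expnMn -expnM.
  have l2 : (N.+1 <= 2 * N)%N by have := tpos (2 * h + 5)%N; rewrite -/N; lia.
  apply: (@leq_trans (2 * (8 * (81 * t ^ 20) * (2 * N) * B))).
    by rewrite leq_mul2l /= leq_mul2r leq_mul ?orbT // leq_mul2l l1.
  have -> : (2 * (8 * (81 * t ^ 20) * (2 * N) * B) =
             2592 * C * t ^ (20 + (2 * h + 5) + (4 * g + 8)))%N.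
    rewrite /N /B (expnD t (20 + (2 * h + 5)) (4 * g + 8)) (expnD t 20 (2 * h + 5)).
    move: (t ^ 20)%N (t ^ (2 * h + 5))%N (t ^ (4 * g + 8))%N => u v w.
    by ring.
  apply: leq_trans (leq_mul tC (leqnn _)) _.
  by rewrite -expnS pow.
have sA' : (t ^ (4 * h + 7) <= 2 * size A)%N.
  move: sA sizeA coll; rewrite eA.
  by move: (t ^ _)%N (size _) (8 * _ * _ * _)%N => a b c; clear; lia.
have wbX : {in words k LX, forall w, (0 < (run w (1, 0)%N).2 < (run w (1, 0)%N).1)%N /\
                   ((run w (1, 0)%N).1 ^ 2 <= p)%N}.
  move=> w wX; have [_ _ /andP[_ q2] _ q5] := wordsP k LX w LX0 k1 wX.
  split=> //; apply: leq_trans tp; rewrite mulnC expnM leq_exp2r //.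
  exact: leq_trans q2 kLX.
have big : (6 * p ^ 4 < size A * size (words k LX) ^ 2)%N.
  have p4 : (p ^ 4 <= 2 ^ (8 * h) * t ^ (8 * h))%N.
    by rewrite e8 !(expnM _ (2 * h)) -expnMn leq_exp2r.
  have x2 : (t ^ (4 * h - 6) <= size (words k LX) ^ 2)%N.
    by rewrite e6 expnM leq_exp2r.
  have ax := leq_mul sA' x2; rewrite -expnD in ax.
  rewrite e7 expnS in ax.
  (* The surviving half turns the 6 to be beaten into 12; 13 makes the inequality strict. *)
  have l : (13 * (2 ^ (8 * h) * t ^ (8 * h)) <= t * t ^ (8 * h))%N.
    by rewrite mulnA leq_mul2r t8 orbT.
  have pp : (0 < p ^ 4)%N by rewrite expn_gt0 p0.
  have := leq_trans (leq_mul (leqnn 13) p4) (leq_trans l ax); rewrite -mulnA.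
  move: pp; move: (p ^ 4)%N (size A * size (words k LX) ^ 2)%N => u v.
  clear; lia.
have [x [a [y [xX aA yX dvd]]]] :=
  denominator_divisible p A (words k LX) pr uA (words_uniq k LX) injA (words_inj k LX) wbX big.
exists x, a, y, LX, LA; split=> //; first by rewrite AW.
  by rewrite LX0 LA0.
rewrite run_triple.
have bound w : w \in words k LX ->
    ((run w (1, 0)%N).1 <= t ^ h)%N /\ ((run w (1, 0)%N).2 <= t ^ h)%N.
  move=> wX; have [_ _ /andP[_ q2] _ /andP[_ q5]] := wordsP k LX w LX0 k1 wX.
  by have q := leq_trans q2 kLX; split=> //; apply: leq_trans (ltnW q5) q.
have [x1 x2] := bound x xX; have [y1 y2] := bound y yX.
have [_ /andP[a2 a1] a3 a4] := wbA a (AW a aA).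
have N3 : (4 * (t ^ h * (N * t ^ h)) <= 4 * p ^ 3)%N.
  rewrite leq_mul2l /=.
  have t3 : ((t ^ (2 * h)) ^ 3 <= p ^ 3)%N by rewrite leq_exp2r.
  by apply: leq_trans t3; rewrite /N -!expnD -expnM pow.
apply: leq_trans N3.
have prod u v w : (u <= t ^ h -> v <= N -> w <= t ^ h ->
    u * (v * w) <= t ^ h * (N * t ^ h))%N.
  by move=> uu vv ww; rewrite leq_mul // leq_mul.
rewrite !mulnDr -[4%N]/(2 + 2)%N mulnDl mul2n -addnn.
by rewrite !leq_add ?prod // (leq_trans a2 a1).
Qed.

Lemma large_prime_fraction :
  exists k p0 : nat, (1 < k)%N /\ forall p : nat, prime p -> (p0 <= p)%N ->
    exists w : seq nat,
      [/\ all (fun b => 0 < b <= k)%N w, head 0%N w = 2%N, last 0%N w = 2%N,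
          (p %| (run w (1, 0)%N).1)%N & ((run w (1, 0)%N).1 <= 4 * p ^ 3)%N].
Proof.
have [k [p0 [k1 H]]] := words_large_prime 14 isT.
exists k, p0; split=> // p pr pp0.
have [x [a [y [LX [LA [[xX yX] aA /andP[LX0 LA0] dvd le]]]]]] := H p pr pp0.
have [x2 xk _ _ _] := wordsP k LX x LX0 k1 xX.
have [y2 yk _ _ _] := wordsP k LX y LX0 k1 yX.
have [_ ak _ _ _] := wordsP k LA a LA0 k1 aA.
exists (x ++ a ++ rev y); split=> //.
- by rewrite !all_cat all_rev xk ak yk.
- by case: (x) x2.
(* The leading 2 of y ends the reversed word, which provides the normalization of the last partial
   quotient. *)
by case: (y) y2 => // b y' /= ->; rewrite rev_cons !last_cat last_rcons.
Qed.

Theorem theorem1 (R : realType) :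
  exists (k : nat) (C0 : R), (0 < k)%N /\ 0 < C0 /\
    forall p : nat, prime p ->
      exists q a : nat,
        (0 < a)%N /\ (a < q)%N /\ coprime a q /\ (p %| q)%N /\
        q%:R <= C0 * p%:R ^+ 30 /\
        partial_quotients_bounded k (a%:R / q%:R).
Proof.
have [k [p0 [k1 H]]] := large_prime_fraction.
(* For a prime p < p0 the fraction 1/p serves: its only partial quotient is p. *)
exists (k + p0)%N, 4; do 2 (split; first by [|lia]).
move=> p pr; have p1 := prime_gt1 pr.
have bound q : (q <= 4 * p ^ 3)%N -> q%:R <= 4 * p%:R ^+ 30 :> R.
  move=> qp; rewrite -natrX -natrM ler_nat (leq_trans qp) // leq_mul2l /=.
  by rewrite leq_exp2l.
have [pp0|pp0] := leqP p0 p; last first.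
  exists p, 1%N; do 3 (split=> //); first exact: coprime1n.
  split; first exact: dvdnn.
  split; first by apply: bound; nia.
  exists [:: p]; first by split; rewrite /= ?andbT ?addr0 ?mul1r //; lia.
  by rewrite /= andbT; lia.
have [w [wk w2 l2 dvd le]] := H p pr pp0.
have w1 : all (leq 1) w by apply: sub_all wk => b /andP[].
have sw : exists s, w = (2 :: s)%N by case: (w) w2 => // b s /= ->; exists s.
have [s sE] := sw.
have s1 : all (leq 1) s by move: w1; rewrite sE => /andP[].
have a0 : (0 < (run w (0, 1)%N).1)%N by rewrite sE run_cons run_pos.
exists (run w (1, 0)%N).1, (run w (0, 1)%N).1; split=> //.
split.
  (* As the word starts with 2, the denominator is at least twice the numerator. *)
  move: a0; rewrite sE !run_cons /= muln1 muln0 addn0 add0n (run_linear s (2, 1)%N) /=.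
  by lia.
split; first by rewrite coprime_sym run_coprime_col.
do 2 (split=> //); first exact: bound.
exists w; last by apply: sub_all wk => b /andP[_ bk]; rewrite (leq_trans bk) ?leq_addr.
by split; rewrite ?l2 // -cf_value_run // natf_div.
Qed.
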